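(* In the setting of the context (a weighted genus two admissible cover over the standard log point, with real-metrised tropicalisation $\Gamma$ and associated function $\lambda$), let $\Delta_1^\circ$ be a connected component of $\Delta^\circ=\{\lambda>0\}$ of genus one. Then there is at least one vertex of positive weight on the boundary of $\Delta_1^\circ$.
   Context: *Admissible cover.* Over $\mathbb C$, let $\psi\colon(C,D_R)\to(T,D_B)$ be a hyperelliptic admissible cover: a finite degree two morphism of nodal curves, $C$ connected of arithmetic genus $2$, $T$ of genus $0$, étale on $C^{sm}\setminus D_R$, simply ramified along the six smooth points $D_R$ mapping to six distinct smooth points $D_B$, mapping nodes to nodes with the same ramification order $1$ or $2$ on both branches. It carries a weight $w\colon V(\Gamma)\to\mathbb N$ on the dual graph of $C$, not identically zero, such that with $w_T(v)=\sum_{v'\mapsto v}w(v')$ every component of $T$ with $w_T=0$ has at least three nodes or branch points. *Metric.* $\Gamma=\mathrm{trop}(C)$ and the tree $\Gamma_T=\mathrm{trop}(T)$ are the dual graphs with positive real edge lengths, where the length of an edge of $\Gamma_T$ is the ramification order (expansion factor) times the length of any edge of $\Gamma$ above it; $\mathrm{trop}(\psi)\colon\Gamma\to\Gamma_T$ is the induced harmonic map of degree two. For a subcurve, genus means arithmetic genus: first Betti number plus sum of vertex genera. *Functions.* A piecewise linear (PL) function has integral slopes on (a subdivision of) $\Gamma$ (half-integral slopes allowed on $\Gamma_T$); $\mathrm{div}(\lambda)(v)$ is the sum of outgoing slopes at $v$; $K_\Gamma(v)=2g(v)-2+\mathrm{val}(v)$. Pullback along $\mathrm{trop}(\psi)$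 composes functions and multiplies divisors by local degrees. On $\Gamma_T$ let $D'(v)=\mathrm{val}(v)-2+\tfrac12\deg(D_B|_v)$ (valence counts edges only); it has degree $1$ and pulls back to $K_\Gamma$. For each vertex $v_0$ of $\Gamma_T$ there is a PL function $\overline\lambda_T$, unique up to constants, with $D'+\mathrm{div}(\overline\lambda_T)=v_0$; its pullback to $\Gamma$ is an *admissible function*. Let $\overline\lambda_1,\dots,\overline\lambda_s$ be all of them and let $\lambda_i$ be $\overline\lambda_i$ shifted by a constant so that vertices with $\lambda_i>0$ have weight $0$ while those with $\lambda_i\ge0$ have total weight $\ge1$ (i.e. the maximum of $\lambda_i$ on vertices of positive weight is $0$). Define $\lambda=\max\{0,\lambda_1,\dots,\lambda_s\}$, a PL function on a subdivision of $\Gamma$ (new vertices have weight $0$), pulled back from a PL function on $\Gamma_T$, and put $\Delta^\circ=\{\lambda>0\}$. *)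

(* Defs.v *)
From HB Require Import structures.
From mathcomp Require Import all_boot all_order all_algebra.
From mathcomp Require Import all_classical all_reals all_analysis.
Set Implicit Arguments.
Unset Strict Implicit.
Unset Printing Implicit Defensive.
Import Order.TTheory GRing.Theory Num.Theory.
Import numFieldNormedType.Exports.
Local Open Scope classical_set_scope.
Local Open Scope ring_scope.

(** Every edge carries an auxiliary orientation; nothing below depends on it,
    except that covers are required to preserve it (the edges upstairs can
    always be oriented by lifting an orientation from downstairs). *)
Record mgraph := MGraph {
  vert : finType;
  edge : finType;
  src : edge -> vert;
  tgt : edge -> vert }.

(** Sum of [F e] over all half-edges [e] at [v]: a loop is counted twice. *)
Definition star_sum (V : nmodType) (G : mgraph) (v : vert G)
    (F : edge G -> V) : V :=
  \sum_(e | src e == v) F e + \sum_(e | tgt e == v) F e.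

Definition valence (G : mgraph) (v : vert G) : nat :=
  star_sum v (fun _ => 1%N).

Definition adj (G : mgraph) (ES : {set edge G}) : rel (vert G) :=
  fun x y => [exists e in ES, ((src e == x) && (tgt e == y))
                           || ((src e == y) && (tgt e == x))].

(** [ES] must consist of edges with both ends in [VS]. *)
Definition betti (G : mgraph) (VS : {set vert G}) (ES : {set edge G}) : int :=
  #|ES|%:Z - #|VS|%:Z + (n_comp (adj ES) VS)%:Z.

Definition arith_genus (G : mgraph) (g : vert G -> nat)
    (VS : {set vert G}) (ES : {set edge G}) : int :=
  betti VS ES + (\sum_(v in VS) g v)%:Z.

Definition gconnected (G : mgraph) : Prop :=
  n_comp (adj [set: edge G]) [set: vert G] = 1%N.

Definition is_tree (G : mgraph) : Prop :=
  gconnected G /\ betti [set: vert G] [set: edge G] = 0.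

Record metric_graph (R : realType) := MetricGraph {
  graph_of :> mgraph;
  len : edge graph_of -> R;
  len_gt0 : forall e, 0 < len e }.

Section Realisation.
Variables (R : realType) (G : metric_graph R).

(** [Inner e x] is the interior point of [e] at distance [\val x] from
    [src e]. *)
Inductive gpoint :=
| Vtx of vert G
| Inner (e : edge G) (x : {x : R | 0 < x < len e}).

(** Parametrisation of the closed edge [e] by its length, extended to all of
    [R] by clamping to [[0, len e]]. *)
Definition edge_pt (e : edge G) (t : R) : gpoint :=
  if insub t is Some x then @Inner e x
  else if t <= 0 then Vtx (src e) else Vtx (tgt e).

HB.instance Definition _ := gen_eqMixin gpoint.
HB.instance Definition _ := gen_choiceMixin gpoint.

(** The topology of the graph obtained by gluing the closed edges along their
    ends: the final topology for the parametrisations of the edges. *)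
Definition graph_open : set_system gpoint :=
  [set U | forall e : edge G, open (edge_pt e @^-1` U)].

Lemma graph_openT : graph_open setT.
Proof. by move=> e; rewrite preimage_setT; exact: openT. Qed.

Lemma graph_openI : setI_closed graph_open.
Proof. by move=> U V oU oV e; rewrite preimage_setI; apply: openI. Qed.

Lemma graph_open_bigU (I : Type) (f : I -> set gpoint) :
  (forall i, graph_open (f i)) -> graph_open (\bigcup_i f i).
Proof.
by move=> of_ e; rewrite preimage_bigcup; apply: bigcup_open => i _; apply: of_.
Qed.

HB.instance Definition _ :=
  isOpenTopological.Build gpoint graph_openT graph_openI graph_open_bigU.

Definition verts_in (A : set gpoint) : {set vert G} :=
  [set v | `[< A (Vtx v) >]]%SET.

Definition edges_in (A : set gpoint) : {set edge G} :=
  [set e | `[< forall t : R, A (edge_pt e t) >]]%SET.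

(** Arithmetic genus of a subset [A] of the realisation, for genera [g] on the
    vertices (all other points have genus [0]).  For an open [A] as well,
    [H_1(A)] consists of the cycles made of edges that are entirely inside [A],
    since the pieces of the other edges retract away. *)
Definition genus_of_subset (g : vert G -> nat) (A : set gpoint) : int :=
  arith_genus g (verts_in A) (edges_in A).

(** Extension, linear on edges, of a function given on the vertices. *)
Definition lin_ext (f : vert G -> R) (p : gpoint) : R :=
  match p with
  | Vtx v => f v
  | Inner e x => f (src e) + \val x / len e * (f (tgt e) - f (src e))
  end.

Definition div (f : vert G -> R) (v : vert G) : R :=
  \sum_(e | src e == v) (f (tgt e) - f (src e)) / len e +
  \sum_(e | tgt e == v) (f (src e) - f (tgt e)) / len e.

Definition half_integral_slopes (f : vert G -> R) : Prop :=
  forall e, exists k : int, (f (tgt e) - f (src e)) / len e = k%:~R / 2.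

End Realisation.

Arguments gpoint {R} G.
Arguments Vtx {R G}.
Arguments Inner {R G} e x : rename.

Definition boundary (T : topologicalType) (A : set T) : set T :=
  closure A `\` interior A.

(** The discrete data of a hyperelliptic admissible cover
    [(C, D_R) -> (T, D_B)] of a genus two curve, together with edge lengths.
    Vertices are components and edges are nodes.  Conversely, over the complex
    numbers all such data come from a cover: by Riemann-Hurwitz, the component
    [v] is two-sheeted over the line with [2 * genus v + 2 > 0] branch points if
    [ldeg v = 2], and isomorphic to it if [ldeg v = 1].  There are no vertex
    genera on the tree since a nodal curve of arithmetic genus [0] has rational
    components. *)
Record hyp_adm_cover (R : realType) := HypAdmCover {
  Gam : metric_graph R;
  GamT : metric_graph R;
  genus : vert Gam -> nat;
  psiV : vert Gam -> vert GamT;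
  psiE : edge Gam -> edge GamT;
  (** degree of the cover restricted to a component *)
  ldeg : vert Gam -> nat;
  (** ramification order at a node, the same on both branches *)
  expf : edge Gam -> nat;
  (** the component containing the [i]-th point of [D_R], resp. of [D_B] *)
  legR : 'I_6 -> vert Gam;
  legB : 'I_6 -> vert GamT;

  Gam_connected : gconnected Gam;
  Gam_genus : arith_genus genus [set: vert Gam]%SET [set: edge Gam]%SET = 2;
  GamT_tree : is_tree GamT;

  psi_src : forall e, src (psiE e) = psiV (src e);
  psi_tgt : forall e, tgt (psiE e) = psiV (tgt e);
  psi_leg : forall i, psiV (legR i) = legB i;

  ldeg_gt0 : forall v, (0 < ldeg v)%N;
  cover_deg2 : forall u, (\sum_(v | psiV v == u) ldeg v = 2)%N;
  (** over a node of [T], the ramification orders of the branches lying on a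
      component of [C] add up to the degree of that component *)
  harmonic_src : forall v f, src f = psiV v ->
    (\sum_(e | (psiE e == f) && (src e == v)) expf e = ldeg v)%N;
  harmonic_tgt : forall v f, tgt f = psiV v ->
    (\sum_(e | (psiE e == f) && (tgt e == v)) expf e = ldeg v)%N;
  expf12 : forall e, expf e = 1%N \/ expf e = 2%N;
  leg_ramified : forall i, ldeg (legR i) = 2%N;
  (** Riemann-Hurwitz for the component [v] over a rational curve,
      [2 g - 2 = - 2 d + deg Ram]: the ramification is supported on the nodes
      and on [D_R], where it is simple *)
  riemann_hurwitz : forall v,
    (2 * genus v + 2 * ldeg v
     = 2 + star_sum v (fun e => (expf e).-1) + #|[set i | legR i == v]%SET|)%N;

  len_dilation : forall e, len (psiE e) = (expf e)%:R * len e }.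

Arguments genus {R} X v : rename.
Arguments legR {R} X i : rename.
Arguments legB {R} X i : rename.

Section AdmissibleFunctions.
Variables (R : realType) (X : hyp_adm_cover R).

(** The map trop(psi) on points: it stretches the edge [e] by [expf e]. *)
Definition trop_psi (p : gpoint (Gam X)) : gpoint (GamT X) :=
  match p with
  | Vtx v => Vtx (psiV v)
  | Inner e x => edge_pt (psiE e) ((expf e)%:R * \val x)
  end.

Definition nb_branch (u : vert (GamT X)) : nat := #|[set i | legB X i == u]%SET|.

Definition weightT (w : vert (Gam X) -> nat) (u : vert (GamT X)) : nat :=
  (\sum_(v | psiV v == u) w v)%N.

Definition stable_weight (w : vert (Gam X) -> nat) : Prop :=
  (exists v, w v != 0%N) /\
  forall u, weightT w u = 0%N -> (3 <= valence u + nb_branch u)%N.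

Definition Dprime (u : vert (GamT X)) : R :=
  (valence u)%:R - 2 + (nb_branch u)%:R / 2.

(** Since [Dprime] and [v0] are supported on vertices, a piecewise linear
    solution of the equation is linear on edges, hence given by its values on
    the vertices. *)
Definition solves (v0 : vert (GamT X)) (lamT : vert (GamT X) -> R) : Prop :=
  half_integral_slopes lamT /\
  forall u, Dprime u + div lamT u = (u == v0)%:R.

Definition pullback (f : gpoint (GamT X) -> R) (p : gpoint (Gam X)) : R :=
  f (trop_psi p).

Definition normalised (w : vert (Gam X) -> nat)
    (lam : gpoint (Gam X) -> R) : Prop :=
  (forall v, 0 < lam (Vtx v) -> w v = 0%N) /\
  (1 <= \sum_(v | (0 <= lam (Vtx v))%R) w v)%N.

(** For every vertex [v0] of the tree, [lamT v0] is the solution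
    attached to [v0], with the constant chosen so that its pullback is
    normalised. *)
Definition admissible_family (w : vert (Gam X) -> nat)
    (lamT : vert (GamT X) -> vert (GamT X) -> R) : Prop :=
  forall v0, solves v0 (lamT v0) /\
             normalised w (pullback (lin_ext (lamT v0))).

Definition lambda (lamT : vert (GamT X) -> vert (GamT X) -> R)
    (p : gpoint (Gam X)) : R :=
  \big[Num.max/0]_(v0 : vert (GamT X)) pullback (lin_ext (lamT v0)) p.

Definition Delta_o (lamT : vert (GamT X) -> vert (GamT X) -> R) :
    set (gpoint (Gam X)) :=
  [set p | 0 < lambda lamT p].

End AdmissibleFunctions.

Definition is_component (T : topologicalType) (U A : set T) : Prop :=
  exists2 p, U p & A = connected_component U p.

(* Main.v *)
(** Let [b(h)] be the number of branch points beyond an oriented edge [h] of the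
    tree.  Summing the defining equation beyond [h] shows that the function with
    pole [v0] has slope [b(h) / 2 - 1] along [h], or [b(h) / 2 - 2] if [v0] lies
    beyond [h].

    A genus one component of [{lambda > 0}] is the full preimage of a subtree
    [S], since a one-sheeted part has genus zero.  By Riemann-Hurwitz, exactly
    one of the edges [h] leaving [S] has [b(h) = 2] or [3]; all the others, [k],
    have [b(k) <= 1].  Beyond [h] there is a pole [u] whose function attains its
    maximum beyond [h] only at the head of [h].  By normalisation this function
    is nonnegative at some vertex [v] of positive weight.  If [v] lies beyond
    [h], then, as [lambda] vanishes somewhere on [h], [v] must be the head of
    [h], and [lambda] is positive on [h] up to there.  Otherwise, as the weights
    vanish on [S], [v] lies beyond some other [k]; among all the functions take
    one, with pole [v0], which is maximal at the tail of [h].  Then [v0] lies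
    beyond [h], so off that part the functions of [v0] and [u] differ by a
    nonnegative constant, and the function of [v0] is nonnegative at [v] but
    decreasing beyond [k]; so [v] is the head of [k]. *)

Require Import Defs.
From mathcomp Require Import all_boot all_order all_algebra.
From mathcomp Require Import all_classical all_reals all_analysis.
From mathcomp Require Import ring lra zify.
Set Implicit Arguments.
Unset Strict Implicit.
Unset Printing Implicit Defensive.
Import Order.TTheory GRing.Theory Num.Theory.
Import numFieldNormedType.Exports.
Local Open Scope classical_set_scope.
Local Open Scope ring_scope.

Lemma connect_ind (T : finType) (e : rel T) (P : T -> Prop) (x : T) :
  P x -> (forall y z, connect e x y -> P y -> e y z -> P z) ->
  forall z, connect e x z -> P z.
Proof.
move=> Px Pe z /connectP[p]; elim/last_ind: p z => [z _ -> //|p y IHp z].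
rewrite rcons_path last_rcons => /andP[xp py] ->.
by apply: (Pe (last x p)) py; [apply/connectP; exists p | exact: IHp].
Qed.

(** * Oriented edges *)

Notation dart G := (edge G * bool)%type.

Section Darts.
Variable G : mgraph.

Implicit Types (d h k : dart G) (ES : {set edge G}).

Definition dtail d : vert G := if d.2 then src d.1 else tgt d.1.
Definition dhead d : vert G := if d.2 then tgt d.1 else src d.1.
Definition drev d : dart G := (d.1, ~~ d.2).

Lemma dtail_rev d : dtail (drev d) = dhead d. Proof. by case: d => e []. Qed.
Lemma dhead_rev d : dhead (drev d) = dtail d. Proof. by case: d => e []. Qed.
Lemma drevK d : drev (drev d) = d. Proof. by case: d => e []. Qed.

Lemma dart_same_edge d k : d.1 = k.1 -> d = k \/ d = drev k.
Proof. by case: d k => e [] [e' []] /= ->; auto. Qed.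

Lemma adjP ES x y :
  reflect (exists d, [/\ d.1 \in ES, dtail d = x & dhead d = y]) (adj ES x y).
Proof.
apply: (iffP existsP) => [[e /andP[eES /orP[]/andP[/eqP <- /eqP <-]]]|].
- by exists (e, true).
- by exists (e, false).
by move=> [[e []] [/= eES <- <-]]; exists e; rewrite eES /dtail /dhead /= !eqxx ?orbT.
Qed.

Lemma adj_dart ES d : d.1 \in ES -> adj ES (dtail d) (dhead d).
Proof. by move=> dES; apply/adjP; exists d. Qed.

Lemma connect_adj_sym ES : connect_sym (adj ES).
Proof.
apply: sym_connect_sym => x y.
by apply/adjP/adjP => -[d [? <- <-]]; exists (drev d); rewrite dtail_rev dhead_rev.
Qed.

Lemma connect_dart ES d x : d.1 \in ES ->
  connect (adj ES) x (dtail d) = connect (adj ES) x (dhead d).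
Proof.
move=> dES; apply: (same_connect_r (connect_adj_sym ES)).
exact/connect1/adj_dart.
Qed.

Lemma sum_darts_at (V : nmodType) (v : vert G) (F : dart G -> V) :
  \sum_(d : dart G | dtail d == v) F d =
  \sum_(e | src e == v) F (e, true) + \sum_(e | tgt e == v) F (e, false).
Proof.
rewrite [X in _ = X + _]big_mkcond [X in _ = _ + X]big_mkcond -big_split.
transitivity (\sum_e \sum_(b : bool) if dtail (e, b) == v then F (e, b) else 0).
  by rewrite pair_bigA big_mkcond; apply: eq_bigr => -[].
by apply: eq_bigr => e _; rewrite big_bool.
Qed.

Lemma star_sumE (V : nmodType) (v : vert G) (F : edge G -> V) :
  star_sum v F = \sum_(d : dart G | dtail d == v) F d.1.
Proof. by rewrite sum_darts_at. Qed.

Lemma sum_dart_in (V : nmodType) (A : {set vert G}) (F : dart G -> V) :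
  \sum_(v in A) \sum_(d : dart G | dtail d == v) F d =
  \sum_(d : dart G | dtail d \in A) F d.
Proof.
rewrite [RHS](partition_big dtail (mem A)) //=.
apply: eq_bigr => v vA; apply: eq_bigl => d.
by rewrite andbC; case: eqP => // ->; rewrite vA.
Qed.

(** Induction on a connected vertex set: adding a vertex across an edge adds
    at least that edge. *)
Lemma card_connect_le ES r :
  (#|[set v | connect (adj ES) r v]%SET| <=
   #|[set e in ES | connect (adj ES) r (src e)]%SET|.+1)%N.
Proof.
pose EA (A : {set vert G}) :=
  [set e in ES | (src e \in A) && (tgt e \in A)]%SET.
pose P (A : {set vert G}) := [&& r \in A, A \subset [set v | connect (adj ES) r v]%SET
             & #|A| <= #|EA A|.+1]%N.
have exP : exists A, P A.
  exists [set r]%SET; rewrite /P inE eqxx finset.sub1set inE connect0 cards1 //.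
have [A /maxsetP[/and3P[rA Ac cA] Amax]] := ex_maxset exP.
have {}Ac : [set v | connect (adj ES) r v]%SET = A.
  apply/eqP; rewrite finset.eqEsubset Ac andbT; apply/fintype.subsetP => z.
  rewrite inE; move: z; apply: connect_ind => // x y rx xA /adjP[d [dES dx dy]].
  apply: contraT => yA; suff /Amax/(_ (finset.subsetUr _ _)) yAE : P (y |: A)%SET.
    by move: yA; rewrite -yAE !inE eqxx.
  rewrite /P !inE rA orbT /=; apply/andP; split.
    by rewrite finset.subUset Ac finset.sub1set inE -dy -connect_dart ?dx ?rx.
  rewrite cardsU1 yA add1n ltnS; apply: (leq_trans cA).
  apply: proper_card; apply/properP; split.
    apply/fintype.subsetP => e; rewrite !inE => /and3P[-> -> ->].
    by rewrite !orbT.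
  exists d.1.
    rewrite !inE dES; move: dx dy xA; case: (d) => e []; rewrite /dtail /dhead /=;
    by move=> -> -> ->; rewrite eqxx !orbT.
  rewrite !inE; move: dx dy yA; case: (d) => e []; rewrite /dtail /dhead /=;
  by move=> -> -> /negPf ->; rewrite ?andbF.
rewrite Ac; apply: (leq_trans cA); rewrite ltnS; apply/subset_leq_card.
apply/fintype.subsetP => e; rewrite !inE => /and3P[-> eA _] /=.
by move: eA; rewrite -{1}Ac inE.
Qed.

Lemma sum_region (V : nmodType) (A : {set vert G}) ES (F : dart G -> V) :
  (forall e, e \in ES -> (src e \in A) && (tgt e \in A)) ->
  \sum_(d : dart G | dtail d \in A) F d =
  \sum_(d : dart G | (dtail d \in A) && (d.1 \notin ES)) F d +
  \sum_(e in ES) (F (e, true) + F (e, false)).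
Proof.
move=> ESA; rewrite (bigID (fun d : dart G => d.1 \in ES)) /= addrC; congr (_ + _).
transitivity (\sum_(e in ES) \sum_(b : bool) F (e, b)); last first.
  by apply: eq_bigr => e _; rewrite big_bool.
rewrite pair_big /=; apply: eq_big => [[e b]|[]//]; rewrite andbT /dtail /=.
have [/ESA/andP[? ?]|] := boolP (e \in ES); last by rewrite andbF.
by case: b; rewrite andbT.
Qed.

(** [#|E| + g = #|V|] says that the class of [r] has genus one.  No class has
    negative genus, so exactly one of the classes carries the genus. *)
Lemma exists_class_genus1 (g : vert G -> nat) (VS : {set vert G}) ES :
  (forall e, e \in ES -> (src e \in VS) = (tgt e \in VS)) ->
  (forall e, e \in ES -> src e \in VS) ->
  arith_genus g VS ES = 1 ->
  exists2 r, r \in VS &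
    (#|[set e in ES | connect (adj ES) r (src e)]%SET| +
     \sum_(v | connect (adj ES) r v) g v =
     #|[set v | connect (adj ES) r v]%SET|)%N.
Proof.
move=> ESE ESV; pose rt := fingraph.root (adj ES); pose cs := @connect_adj_sym ES.
have rtE r v : roots (adj ES) r -> (rt v == r) = connect (adj ES) r v.
  by move=> /eqP rr; rewrite -{1}rr root_connect // cs.
have VS_rt v : (rt v \in VS) = (v \in VS).
  suff VS_connect x : connect (adj ES) v x -> (x \in VS) = (v \in VS).
    by rewrite VS_connect // connect_root.
  move: x; apply: connect_ind => // y z _ <- /adjP[[e b] [/ESE eE <- <-]].
  by move: eE; rewrite /dtail /dhead /=; case: b => ->.
pose P r := roots (adj ES) r && (r \in VS).
have Prt v : P (rt v) = (v \in VS) by rewrite /P roots_root //= VS_rt.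
pose nE r := #|[set e in ES | connect (adj ES) r (src e)]%SET|.
pose nV r := #|[set v | connect (adj ES) r v]%SET|.
pose gen r := (\sum_(v | connect (adj ES) r v) g v)%N.
have sumE : #|ES| = (\sum_(r | P r) nE r)%N.
  rewrite -sum1_card (partition_big (fun e => rt (src e)) P) => [|e /ESV]; last by rewrite Prt.
  apply: eq_bigr => r /andP[rr _]; rewrite /nE -sum1dep_card.
  by apply: eq_bigl => e; rewrite rtE.
have sumV : #|VS| = (\sum_(r | P r) nV r)%N.
  rewrite -sum1_card (partition_big rt P) => [|v]; last by rewrite Prt.
  apply: eq_bigr => r /andP[rr rV]; rewrite /nV -sum1dep_card.
  apply: eq_bigl => v; rewrite rtE // andbC; have [/= rv|//] := boolP (connect _ _ _).
  by rewrite -VS_rt; move: rv; rewrite -rtE // => /eqP ->.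
have sumg : (\sum_(v in VS) g v = \sum_(r | P r) gen r)%N.
  rewrite (partition_big rt P) => [|v]; last by rewrite Prt.
  apply: eq_bigr => r /andP[rr rV]; rewrite /gen; apply: eq_bigl => v.
  rewrite rtE // andbC; have [/= rv|//] := boolP (connect _ _ _).
  by rewrite -VS_rt; move: rv; rewrite -rtE // => /eqP ->.
have nVE r : (nV r <= (nE r).+1 + gen r)%N.
  exact: leq_trans (card_connect_le _ _) (leq_addr _ _).
rewrite /arith_genus /betti.
have -> : n_comp (adj ES) VS = (\sum_(r | P r) 1)%N.
  by rewrite sum1_card; apply: eq_card => r; rewrite !unfold_in.
move=> gen1; have : (\sum_(r | P r) ((nE r).+1 + gen r - nV r) == 1)%N.
  rewrite sumnB => [|r _]; last exact: nVE.
  rewrite (eq_bigr (fun r => nE r + 1 + gen r)%N) => [|r _]; last by rewrite addn1.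
  by rewrite !big_split /= -sumE -sumV -sumg; lia.
move=> /sum_nat_eq1[r [/andP[_ rV] rE _]]; exists r => //.
by move: rE (nVE r); rewrite /nE /nV /gen; lia.
Qed.

Definition side h : {set vert G} :=
  [set y | connect (adj (~: [set h.1])) (dhead h) y]%SET.

Lemma dhead_side h : dhead h \in side h.
Proof. by rewrite inE connect0. Qed.

Lemma side_dart h k : k.1 != h.1 ->
  (dtail k \in side h) = (dhead k \in side h).
Proof. by move=> kh; rewrite !inE connect_dart // !inE. Qed.

End Darts.

(** * Trees *)

Section Tree.
Variables (G : mgraph) (treeG : is_tree G).
Implicit Types (d h k : dart G) (x y z : vert G).

Lemma tree_connect x y : connect (adj [set: edge G]%SET) x y.
Proof.
case: treeG => n1 _; rewrite -(root_connect (@connect_adj_sym _ _)).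
have [r rP] := mem_card1 n1.
have rr z : fingraph.root (adj [set: edge G]%SET) z = r.
  apply/eqP; have := rP (fingraph.root (adj [set: edge G]%SET) z).
  rewrite unfold_in /= (roots_root (@connect_adj_sym _ _)) /= in_setT => /esym.
  by rewrite !inE.
by rewrite !rr.
Qed.

Lemma tree_card : #|edge G|.+1 = #|vert G|.
Proof.
case: treeG => n1; rewrite /betti !cardsT.
suff -> : n_comp (adj [set: edge G]%SET) [set: vert G]%SET = 1%N by lia.
rewrite -n1; apply: eq_card => x.
by rewrite !unfold_in /= finset.in_setT in_setT.
Qed.

Lemma side_or h z : z \in side h \/ z \in side (drev h).
Proof.
move: z (tree_connect (dhead h) z).
apply: connect_ind => [|y z _ yh /adjP[k [_ ky kz]]]; first by left; exact: dhead_side.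
have [/dart_same_edge[kh|kh]|kh] := eqVneq k.1 h.1; subst.
- by left; exact: dhead_side.
- by right; rewrite -/(drev h); exact: dhead_side.
by move: yh; rewrite !side_dart.
Qed.

Lemma dtail_side h : dtail h \notin side h.
Proof.
apply/negP => th.
have sT z : z \in side h.
  have [//|] := side_or h z; rewrite !inE dhead_rev; apply: connect_trans.
  by move: th; rewrite inE.
have : (#|vert G| <= #|~: [set h.1]|.+1)%N.
  rewrite -(cardsT (vert G)) (_ : [set: vert G]%SET = side h); last first.
    by apply/finset.setP => z; rewrite sT inE.
  apply: (leq_trans (card_connect_le _ _)).
  by rewrite ltnS subset_leq_card //; apply/fintype.subsetP => e; rewrite inE => /andP[].
have : (0 < #|edge G|)%N by apply/card_gt0P; exists h.1.
by rewrite cardsC1 -tree_card; lia.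
Qed.

Lemma side_drev h z : (z \in side (drev h)) = (z \notin side h).
Proof.
apply/idP/idP => [zr|/negPf zh]; last by have [|//] := side_or h z; rewrite zh.
apply/negP => zh; have := dtail_side h; rewrite inE => /negP; apply.
move: zh zr; rewrite !inE dhead_rev => zh zr; apply: (connect_trans zh).
by rewrite connect_adj_sym.
Qed.

(** The subtree beyond [h], together with [h] itself, is connected and avoids
    any other edge which has an end outside it. *)
Lemma connect_avoid h k z : k.1 != h.1 -> dtail k \notin side h ->
  z \in side h -> connect (adj (~: [set k.1])%SET) (dtail h) z.
Proof.
move=> kh tk; rewrite inE; move: z; apply: connect_ind.
  by apply/connect1/adj_dart; rewrite !inE eq_sym.
move=> y z hy ty /adjP[d [dh dy dz]].
apply: (connect_trans ty); rewrite -dy -dz; apply/connect1/adj_dart.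
rewrite !inE; apply: contra tk => /eqP/dart_same_edge[] dk.
  by rewrite -dk dy inE.
rewrite -dhead_rev -dk -side_dart ?dy ?inE //.
by move: dh; rewrite !inE.
Qed.

Lemma exists_dart_to x y : x != y -> exists2 d, dtail d = x & y \in side d.
Proof.
rewrite eq_sym; move: y (tree_connect x y); apply: connect_ind; first by rewrite eqxx.
move=> y z _ IHy /adjP[k [_ ky kz]] zx.
have [yx|/IHy[d dx yd]] := eqVneq y x.
  by exists k; rewrite ?ky // -kz dhead_side.
exists d => //; rewrite -kz -side_dart ?ky //.
apply/eqP => /dart_same_edge[] kd; subst.
  by move: yd; rewrite (negPf (dtail_side _)).
by rewrite dhead_rev eqxx in zx.
Qed.

Lemma side_sub h k : dtail k = dhead h -> k.1 != h.1 -> side k \subset side h.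
Proof.
move=> tk kh; apply/fintype.subsetP => z zk; apply: contraT.
rewrite -side_drev => /(@connect_avoid (drev h) k z kh).
rewrite side_drev negbK tk dhead_side dtail_rev -tk => /(_ isT) zt.
have := dtail_side k; rewrite inE => /negP[]; move: zk; rewrite inE => zk.
by apply: (connect_trans zk); rewrite connect_adj_sym.
Qed.

Lemma side_proper h k : dtail k = dhead h -> k.1 != h.1 -> side k \proper side h.
Proof.
move=> tk kh; apply/properP; split; first exact: side_sub.
by exists (dhead h); rewrite ?dhead_side // -tk dtail_side.
Qed.

Lemma side_disjoint h k z : dtail h = dtail k -> h.1 != k.1 ->
  z \in side h -> z \notin side k.
Proof.
move=> hk ne zh; rewrite -side_drev; apply: (fintype.subsetP (side_sub _ _)) zh => //.
by rewrite dhead_rev.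
Qed.

Lemma exists_next_dart h y : y \in side h -> y != dhead h ->
  exists k, [/\ dtail k = dhead h, k.1 != h.1 & y \in side k].
Proof.
move=> yh; rewrite eq_sym => /exists_dart_to[k tk yk]; exists k; split=> //.
apply/eqP => /dart_same_edge[] kh; subst.
  by have := dtail_side h; rewrite tk dhead_side.
by move: yk; rewrite side_drev yh.
Qed.

(** Send an edge to its end away from [s]. *)
Lemma tree_card_edges (A : {set vert G}) (ES : {set edge G}) s :
  s \in A -> (forall e, e \in ES -> src e \in A /\ tgt e \in A) ->
  (#|ES| < #|A|)%N.
Proof.
move=> sA ESA; pose far e := (e, s \notin side (e, true)) : dart G.
have s_far e : s \notin side (far e).
  rewrite /far; case: (boolP (s \in side (e, true))) => // se.
  by rewrite -[(e, ~~ true)]/(drev (e, true)) side_drev se.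
suff <- : #|[set dhead (far e) | e in ES]%SET| = #|ES|.
  rewrite [ltnRHS](cardsD1 s) sA ltnS; apply: subset_leq_card.
  apply/fintype.subsetP => _ /imsetP[e /ESA[sE tE] ->]; rewrite !inE.
  apply/andP; split; first by apply: contraNneq (s_far e) => <-; exact: dhead_side.
  by rewrite /dhead; case: ifP.
apply: card_in_imset => e e' _ _ ee'; apply/eqP; apply: contraT => ne.
suff : s \notin side (drev (far e')) by rewrite side_drev s_far.
by apply: (@side_disjoint (drev (far e))); rewrite ?dtail_rev // side_drev.
Qed.

Lemma card_side_edges h :
  #|side h| = #|[set e | (e != h.1) && (src e \in side h)]%SET|.+1.
Proof.
apply/eqP; rewrite eqn_leq; apply/andP; split.
  apply: (leq_trans (card_connect_le _ _)); rewrite ltnS subset_leq_card //.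
  by apply/fintype.subsetP => e; rewrite !inE.
apply: (tree_card_edges (s := dhead h)); first exact: dhead_side.
move=> e; rewrite inE => /andP[eh es]; split=> //.
by rewrite -(@side_dart _ h (e, true)).
Qed.

Lemma sum_side (V : nmodType) (F : dart G -> V) h :
  \sum_(k : dart G | dtail k \in side h) F k =
  F (drev h) +
  \sum_(e | (e != h.1) && (src e \in side h)) (F (e, true) + F (e, false)).
Proof.
rewrite (@sum_region _ _ _ [set e | (e != h.1) && (src e \in side h)]%SET) => [|e].
  congr (_ + _); last by apply: eq_bigl => e; rewrite inE.
  rewrite (bigD1 (drev h)) /=; last by rewrite dtail_rev dhead_side inE eqxx.
  rewrite big1 ?addr0 // => k /andP[]; rewrite ![_.1 \in _]inE.
  have [/dart_same_edge[]->|kh] := eqVneq k.1 h.1.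
  - by rewrite (negPf (dtail_side h)).
  - by rewrite eqxx.
  rewrite /= (_ : (src k.1 \in side h) = (dtail k \in side h)) ?andbN //.
  by case: k kh => e [] //= kh; rewrite (@side_dart _ h (e, true)).
rewrite inE => /andP[eh es]; rewrite es.
by rewrite -(@side_dart _ h (e, true)) // es.
Qed.

End Tree.

(** * Slopes of the functions on the tree *)

Section Slopes.
Variables (R : realType) (X : hyp_adm_cover R).
Local Notation T := (GamT X).
Implicit Types (h k : dart T) (u v y : vert T).

Let treeT : is_tree T := @GamT_tree R X.

Definition slope (f : vert T -> R) h : R := (f (dhead h) - f (dtail h)) / len h.1.

Lemma slope_rev f h : slope f (drev h) = - slope f h.
Proof. by rewrite /slope dhead_rev dtail_rev -mulNr opprB. Qed.

Lemma slope_lt0 f h : (slope f h < 0) = (f (dhead h) < f (dtail h)).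
Proof. by rewrite /slope pmulr_llt0 ?subr_lt0 // invr_gt0 len_gt0. Qed.

Definition branches h : nat := #|[set i | legB X i \in side h]%SET|.

Lemma sum_nb_branch (A : {set vert T}) :
  (\sum_(u in A) nb_branch u = #|[set i | legB X i \in A]%SET|)%N.
Proof.
rewrite -sum1dep_card (partition_big (legB X) (mem A)) //=.
apply: eq_bigr => u uA; rewrite /nb_branch -sum1dep_card; apply: eq_bigl => i.
by rewrite andbC; case: eqP => // ->; rewrite uA.
Qed.

Lemma valenceE u : valence u = #|[set d : dart T | dtail d == u]%SET|.
Proof. by rewrite /valence star_sumE -sum1dep_card. Qed.

Lemma sum_div_side f h : \sum_(u in side h) div f u = - slope f h.
Proof.
transitivity (\sum_(u in side h) \sum_(k : dart T | dtail k == u) slope f k).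
  by apply: eq_bigr => u _; rewrite sum_darts_at.
rewrite sum_dart_in (sum_side treeT) slope_rev big1 ?addr0 // => e _.
by rewrite -[(e, false)]/(drev (e, true)) slope_rev subrr.
Qed.

Lemma sum_Dprime_side h :
  \sum_(u in side h) Dprime u = (branches h)%:R / 2 - 1.
Proof.
rewrite /Dprime !big_split /= -mulr_suml -[X in _ + X / 2]natr_sum sum_nb_branch.
have -> : \sum_(u in side h) (valence u)%:R = 2 * (#|side h|)%:R - 1 :> R.
  transitivity (\sum_(u in side h) \sum_(k : dart T | dtail k == u) (1 : R)).
    by apply: eq_bigr => u _; rewrite valenceE -sum1dep_card natr_sum.
  rewrite sum_dart_in (sum_side treeT) sumr_const (card_side_edges treeT).
  by rewrite cardsE -mulr_natl -natr1; ring.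
rewrite sumr_const -/(branches h) -mulr_natl; ring.
Qed.

Lemma slope_solves v0 f h : solves v0 f ->
  slope f h = (branches h)%:R / 2 - 1 - (v0 \in side h)%:R.
Proof.
move=> [_ fE]; have : \sum_(u in side h) (Dprime u + div f u) = (v0 \in side h)%:R.
  under eq_bigr do rewrite fE.
  case: (boolP (v0 \in side h)) => v0h.
    by rewrite (bigD1 v0) //= eqxx big1 ?addr0 // => u /andP[_ /negPf ->].
  by rewrite big1 // => u uh; case: eqP uh v0h => // -> ->.
by rewrite big_split /= sum_Dprime_side sum_div_side => <-; ring.
Qed.

Lemma branches_sub h k : side k \subset side h -> (branches k <= branches h)%N.
Proof.
move=> kh; apply/subset_leq_card/fintype.subsetP => i; rewrite ![i \in _]inE.
exact: (fintype.subsetP kh).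
Qed.

Lemma branches_disjoint h k k' : side k \subset side h -> side k' \subset side h ->
  (forall y, y \in side k -> y \notin side k') ->
  (branches k + branches k' <= branches h)%N.
Proof.
move=> kh kh' dis; rewrite /branches -cardsUI.
rewrite [X in (_ + X)%N](_ : _ = 0%N) ?addn0.
  apply/subset_leq_card/fintype.subsetP => i; rewrite ![i \in _]inE.
  by case/orP; [exact: (fintype.subsetP kh) | exact: (fintype.subsetP kh')].
apply/eqP; rewrite cards_eq0; apply/eqP/finset.setP => i; rewrite ![i \in _]inE.
by case: (boolP (legB X i \in side k)) => // /dis/negPf ->.
Qed.

Variable lamT : vert T -> vert T -> R.
Hypothesis lam_solves : forall v0, solves v0 (lamT v0).

Lemma slope_lam v0 h :
  slope (lamT v0) h = (branches h)%:R / 2 - 1 - (v0 \in side h)%:R.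
Proof. exact: slope_solves. Qed.

Lemma lam_decr1 v0 h : (branches h <= 1)%N -> v0 \notin side h ->
  lamT v0 (dhead h) < lamT v0 (dtail h).
Proof.
move=> bh /negPf v0h; rewrite -slope_lt0 slope_lam v0h /=.
have : (branches h)%:R <= 1 :> R by rewrite lern1.
by lra.
Qed.

Lemma lam_decr2 v0 h : (branches h <= 3)%N -> v0 \in side h ->
  lamT v0 (dhead h) < lamT v0 (dtail h).
Proof.
move=> bh v0h; rewrite -slope_lt0 slope_lam v0h /=.
have : (branches h)%:R <= 3 :> R by rewrite ler_nat.
by lra.
Qed.

Lemma lam_side_lt_tail v0 h : (branches h <= 1)%N -> v0 \notin side h ->
  forall y, y \in side h -> lamT v0 y < lamT v0 (dtail h).
Proof.
have [n] := ubnP #|side h|; elim: n h => // n IHn h /ltnSE hn bh v0h y yh.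
have dh := lam_decr1 bh v0h.
have [->//|/(exists_next_dart treeT yh)[k [tk kh yk]]] := eqVneq y (dhead h).
have sub := side_sub treeT tk kh.
apply: (lt_trans _ dh); rewrite -tk; apply: IHn => //.
- exact: leq_trans (proper_card (side_proper treeT tk kh)) hn.
- exact: leq_trans (branches_sub sub) bh.
- by apply: contra v0h; exact: (fintype.subsetP sub).
Qed.

Lemma lam_side_lt_head v0 h : (branches h <= 1)%N -> v0 \notin side h ->
  forall y, y \in side h -> y != dhead h -> lamT v0 y < lamT v0 (dhead h).
Proof.
move=> bh v0h y yh /(exists_next_dart treeT yh)[k [tk kh yk]].
have sub := side_sub treeT tk kh.
rewrite -tk; apply: lam_side_lt_tail => //.
  exact: leq_trans (branches_sub sub) bh.
by apply: contra v0h; exact: (fintype.subsetP sub).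
Qed.

(** Move the pole away from [h] as long as at least two branch points lie
    ahead: on each side branch that is left behind there is then at most one. *)
Lemma exists_pole h : (branches h <= 3)%N ->
  exists2 u, u \in side h &
  forall y, y \in side h -> y != dhead h -> lamT u y < lamT u (dhead h).
Proof.
have [n] := ubnP #|side h|; elim: n h => // n IHn h /ltnSE hn bh.
have [k /and3P[/eqP tk kh bk]|nobranch] :=
    pickP (fun k => [&& dtail k == dhead h, k.1 != h.1 & (1 < branches k)%N]).
  have sub := side_sub treeT tk kh.
  have bk3 : (branches k <= 3)%N := leq_trans (branches_sub sub) bh.
  have [|u uk uP] := IHn k _ bk3.
    exact: leq_trans (proper_card (side_proper treeT tk kh)) hn.
  exists u; first exact: (fintype.subsetP sub).
  move=> y yh yne; have dk := lam_decr2 bk3 uk; rewrite tk in dk.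
  have [yk|yk] := boolP (y \in side k).
    by have [->//|/(uP y yk)/lt_trans] := eqVneq y (dhead k); apply.
  have [k' [tk' kh' yk']] := exists_next_dart treeT yh yne.
  have kk' : k.1 != k'.1.
    apply: contra yk => /eqP/dart_same_edge[->//|kk].
    have := dhead_side k'; rewrite -[dhead k']dtail_rev -kk tk -tk'.
    by rewrite (negPf (dtail_side treeT k')).
  have := branches_disjoint sub (side_sub treeT tk' kh')
    (fun z => @side_disjoint _ treeT k k' z (etrans tk (esym tk')) kk').
  move=> bkk'; rewrite -tk'; apply: lam_side_lt_tail => //; first by lia.
  by apply: (side_disjoint treeT _ kk'); rewrite ?tk.
exists (dhead h); first exact: dhead_side.
move=> y yh yne; have [k [tk kh yk]] := exists_next_dart treeT yh yne.
rewrite -tk; apply: lam_side_lt_tail => //; last exact: dtail_side.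
by have := nobranch k; rewrite tk eqxx kh /= ltnNge => /negbFE.
Qed.

Lemma lam_sub_const h u v y : u \in side h -> v \in side h -> y \notin side h ->
  lamT u y - lamT v y = lamT u (dtail h) - lamT v (dtail h).
Proof.
move=> uh vh; rewrite -(side_drev treeT) inE dhead_rev; move: y.
apply: connect_ind => // y z ty <- /adjP[k]; rewrite !inE => -[kh ky kz].
have tk : dtail k \notin side h.
  by rewrite -(side_drev treeT) inE dhead_rev ky.
have inv a : a \in side h -> (a \in side k) = (dtail h \in side k).
  move=> ah; have := @connect_avoid _ h k a kh tk ah.
  rewrite !inE connect_adj_sym => ta; rewrite ![connect _ (dhead k) _]connect_adj_sym.
  by rewrite (same_connect (@connect_adj_sym _ _) ta).
have := slope_lam u k; have := slope_lam v k; rewrite !inv //.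
move=> <- /eqP; rewrite /slope ky kz => /eqP/(divIf (lt0r_neq0 (len_gt0 k.1))).
by lra.
Qed.

End Slopes.

(** * Riemann-Hurwitz counts *)

Section Cover.
Variables (R : realType) (X : hyp_adm_cover R).
Local Notation T := (GamT X).
Local Open Scope nat_scope.
Implicit Types (d : dart (Gam X)) (h k : dart T) (u : vert T) (v : vert (Gam X)).

Let treeT : is_tree T := @GamT_tree R X.

Definition psiD d : dart T := (psiE d.1, d.2).

Lemma dtail_psi d : dtail (psiD d) = psiV (dtail d).
Proof. by case: d => e []; rewrite /dtail /= (psi_src, psi_tgt). Qed.

Lemma psiD_rev d : psiD (drev d) = drev (psiD d).
Proof. by []. Qed.

Lemma dhead_psi d : dhead (psiD d) = psiV (dhead d).
Proof. by rewrite -dtail_rev -psiD_rev dtail_psi dtail_rev. Qed.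

Lemma psiD_eq_rev d k : (psiD (drev d) == k) = (psiD d == drev k).
Proof. by rewrite psiD_rev (can2_eq (@drevK _) (@drevK _)). Qed.

Lemma reindex_drev (P : pred (dart (Gam X))) (F : dart (Gam X) -> nat) :
  \sum_(d : dart (Gam X) | P d) F d =
  \sum_(d : dart (Gam X) | P (drev d)) F (drev d).
Proof. by rewrite (reindex_inj (can_inj (@drevK _))). Qed.

Lemma harmonic v k : dtail k = psiV v ->
  \sum_(d : dart (Gam X) | (psiD d == k) && (dtail d == v)) expf d.1 = ldeg v.
Proof.
case: k => f b fv.
rewrite (reindex_onto (fun e => (e, b) : dart (Gam X)) fst) /=; last first.
  by case=> e c /andP[/eqP[_ ->]].
case: b fv => /= fv.
  rewrite -(harmonic_src fv); apply: eq_bigl => e; rewrite eqxx andbT.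
  by rewrite /psiD /= xpair_eqE eqxx andbT.
rewrite -(harmonic_tgt fv); apply: eq_bigl => e; rewrite eqxx andbT.
by rewrite /psiD /= xpair_eqE eqxx andbT.
Qed.

Lemma exists_lift v k : dtail k = psiV v -> exists2 d, psiD d = k & dtail d = v.
Proof.
move=> /harmonic kv; have := ldeg_gt0 v; rewrite -kv => lt0.
have [d /andP[/eqP ? /eqP ?]|none] :=
    pickP (fun d => (psiD d == k) && (dtail d == v)); first by exists d.
by move: lt0; rewrite big_pred0.
Qed.

Lemma expf_gt0 (e : edge (Gam X)) : 0 < expf e.
Proof. by have [] := @expf12 _ X e => ->. Qed.

Lemma sum_expf_at v :
  star_sum v (fun e => (expf e).-1) + \sum_(d : dart (Gam X) | dtail d == v) 1 =
  \sum_(d : dart (Gam X) | dtail d == v) expf d.1.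
Proof.
rewrite star_sumE -big_split /=; apply: eq_bigr => d _.
by have := expf_gt0 d.1; case: expf => // n _; rewrite /= addn1.
Qed.

Section Region.
Variables (C : {set vert (Gam X)}) (S : {set vert T}) (deg : nat).
Hypothesis CS : forall v, v \in C -> psiV v \in S.
Hypothesis degC : forall u, u \in S -> \sum_(v in C | psiV v == u) ldeg v = deg.

Lemma sum_expf_over k : dtail k \in S ->
  \sum_(d : dart (Gam X) | (psiD d == k) && (dtail d \in C)) expf d.1 = deg.
Proof.
move=> kS; rewrite -(degC kS).
rewrite (partition_big (@dtail _) (fun v => (v \in C) && (psiV v == dtail k))) /=.
  apply: eq_bigr => v /andP[vC /eqP vk]; rewrite -(harmonic (esym vk)).
  apply: eq_bigl => d; rewrite -andbA; congr (_ && _).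
  by rewrite andbC; case: eqP => // ->.
by move=> d /andP[/eqP <- ->]; rewrite dtail_psi eqxx.
Qed.

Definition lifts k := #|[set d | (psiD d == k) && (dtail d \in C)]%SET|.

Lemma card_darts_lifts :
  #|[set d | dtail d \in C]%SET| = \sum_(k : dart T | dtail k \in S) lifts k.
Proof.
rewrite -sum1dep_card (partition_big psiD (fun k => dtail k \in S)) /=.
  by apply: eq_bigr => k _; rewrite /lifts -sum1dep_card; apply: eq_bigl => d; rewrite andbC.
by move=> d /CS; rewrite dtail_psi.
Qed.

Lemma riemann_hurwitz_region :
  2 * (\sum_(v in C) genus X v) + 2 * (deg * #|S|) +
    \sum_(k : dart T | dtail k \in S) lifts k =
  2 * #|C| + deg * #|[set k : dart T | dtail k \in S]%SET|
    + #|[set i | legR X i \in C]%SET|.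
Proof.
have ldegC : \sum_(v in C) ldeg v = deg * #|S|.
  rewrite (partition_big (@psiV _ X) (mem S)) //= mulnC -sum_nat_const.
  by apply: eq_bigr => u /degC.
have expfC : \sum_(d : dart (Gam X) | dtail d \in C) expf d.1 =
    deg * #|[set k : dart T | dtail k \in S]%SET|.
  rewrite (partition_big psiD (fun k => dtail k \in S)) /=; last first.
    by move=> d /CS; rewrite dtail_psi.
  rewrite mulnC -sum_nat_const big_mkcond [RHS]big_mkcond /=; apply: eq_bigr => k _.
  rewrite inE; case: ifP => // kS; rewrite -(sum_expf_over kS).
  by apply: eq_bigl => d; rewrite andbC.
have legC : #|[set i | legR X i \in C]%SET| =
    \sum_(v in C) #|[set i | legR X i == v]%SET|.
  rewrite -sum1dep_card (partition_big (legR X) (mem C)) //=.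
  apply: eq_bigr => v vC; rewrite -sum1dep_card; apply: eq_bigl => i.
  by rewrite andbC; case: eqP => // ->; rewrite vC.
have dartsC F : \sum_(d : dart (Gam X) | dtail d \in C) F d =
    \sum_(v in C) \sum_(d : dart (Gam X) | dtail d == v) F d.
  exact: esym (sum_dart_in _ _).
rewrite -card_darts_lifts -expfC -ldegC legC -sum1dep_card !dartsC -sum1_card.
rewrite !big_distrr /= -!big_split /=; apply: eq_bigr => v vC.
by rewrite riemann_hurwitz -sum_expf_at muln1 addnAC !addnA.
Qed.

End Region.

Definition over k := #|[set d | psiD d == k]%SET|.

Lemma over_rev k : over (drev k) = over k.
Proof.
rewrite /over -!sum1dep_card reindex_drev; apply: eq_bigl => d.
by rewrite psiD_eq_rev drevK.
Qed.

Lemma over_gt0 k : 0 < over k.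
Proof.
suff [v kv] : exists v, dtail k = psiV v.
  by have [d dk _] := exists_lift kv; apply/card_gt0P; exists d; rewrite inE dk.
have [v /eqP vk|none] := pickP (fun v => psiV v == dtail k); first by exists v.
by have := cover_deg2 (dtail k); rewrite big_pred0.
Qed.

Definition preim_vert (S : {set vert T}) : {set vert (Gam X)} :=
  [set v | psiV v \in S]%SET.

Lemma deg_preim_vert (S : {set vert T}) u : u \in S ->
  \sum_(v in preim_vert S | psiV v == u) ldeg v = 2.
Proof.
move=> uS; rewrite -(cover_deg2 u); apply: eq_bigl => v.
by rewrite inE andbC; case: eqP => // ->.
Qed.

Lemma lifts_preim_vert (S : {set vert T}) k : dtail k \in S ->
  lifts (preim_vert S) k = over k.
Proof.
move=> kS; apply: eq_card => d; rewrite !inE.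
by have [dk|//] := eqVneq (psiD d) k; rewrite -dtail_psi dk.
Qed.

Lemma over_le2 k : over k <= 2.
Proof.
rewrite -(@sum_expf_over (preim_vert [set dtail k]%SET) [set dtail k]%SET 2
  (@deg_preim_vert _) k (set11 _)).
rewrite -(@lifts_preim_vert [set dtail k]%SET) ?finset.set11 // /lifts -sum1dep_card.
by apply: leq_sum => d _; exact: expf_gt0.
Qed.

Lemma card_legs_preim (S : {set vert T}) :
  #|[set i | legR X i \in preim_vert S]%SET| = #|[set i | legB X i \in S]%SET|.
Proof. by apply: eq_card => i; rewrite !inE psi_leg. Qed.

(** Riemann-Hurwitz for the part of the curve over the far side of [h]. *)
Lemma odd_over h : odd (over h) = odd (branches h).
Proof.
have pre v : v \in preim_vert (side h) -> psiV v \in side h by rewrite inE.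
have := riemann_hurwitz_region pre (@deg_preim_vert _).
have sum_over : \sum_(k : dart T | dtail k \in side h) over k = over (drev h) +
    \sum_(e | (e != h.1) && (src e \in side h)) (over (e, true) + over (e, false)).
  exact: sum_side.
rewrite card_legs_preim -/(branches h).
rewrite (eq_bigr over) => [|k]; last exact: lifts_preim_vert.
rewrite sum_over over_rev (eq_bigr (fun e => 2 * over (e, true))); last first.
  by move=> e _; rewrite -[(e, false)]/(drev (e, true)) over_rev mul2n addnn.
by rewrite -big_distrr /=; lia.
Qed.

(** [Ep] is a set of edges of the tree, [VS] a union of connected components of
    the part of [Gam X] over [Ep]. *)
Section Component.
Variables (Ep : {set edge T}) (VS : {set vert (Gam X)}).
Hypothesis VSE : forall e : edge (Gam X),
  psiE e \in Ep -> (src e \in VS) = (tgt e \in VS).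

Definition lift_edges : {set edge (Gam X)} :=
  [set e | (psiE e \in Ep) && (src e \in VS)]%SET.

Variable v0 : vert (Gam X).
Hypothesis v0VS : v0 \in VS.

Let C : {set vert (Gam X)} := [set v | connect (adj lift_edges) v0 v]%SET.
Let S : {set vert T} := [set u | connect (adj Ep) (psiV v0) u]%SET.
Let ES : {set edge T} := [set f in Ep | src f \in S]%SET.

Definition is_exit k := (dtail k \in S) && (k.1 \notin Ep).

Lemma class_sub v : v \in C -> v \in VS.
Proof.
rewrite inE; move: v; apply: connect_ind => // v v' _ vV /adjP[[e b]].
rewrite inE /dtail /dhead => -[/= /andP[eE eV] _ <-].
by case: b; rewrite // -VSE.
Qed.

Lemma class_dart d : (psiD d).1 \in Ep -> (dtail d \in C) = (dhead d \in C).
Proof.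
move=> dE; have [dl|dl] := boolP (d.1 \in lift_edges); first by rewrite !inE connect_dart.
have dV : dtail d \notin VS /\ dhead d \notin VS.
  move: dl dE; case: d => e b; rewrite inE /psiD /= => + eE; rewrite eE /=.
  by have := VSE eE; rewrite /dtail /dhead /=; case: b => /= <- /negPf ->.
by rewrite !(contraNF (@class_sub _)) //; case: dV.
Qed.

Lemma base_dart k : k.1 \in Ep -> (dtail k \in S) = (dhead k \in S).
Proof. by move=> kE; rewrite !inE connect_dart. Qed.

Lemma class_base v : v \in C -> psiV v \in S.
Proof.
rewrite inE; move: v; apply: connect_ind; first by rewrite inE connect0.
move=> v v' _ vS /adjP[d [+ dv dv']]; rewrite inE => /andP[dE _].
by rewrite -dv' -dhead_psi -base_dart // dtail_psi dv.
Qed.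

Lemma ES_ends f : f \in ES -> (src f \in S) && (tgt f \in S).
Proof.
rewrite inE => /andP[fE fS].
by have := @base_dart (f, true) fE; rewrite /dtail /dhead /= => <-; rewrite fS.
Qed.

Lemma ES_exit k : dtail k \in S -> (k.1 \notin ES) = (k.1 \notin Ep).
Proof.
move=> kS; rewrite inE negb_and; have [kE|//] := boolP (k.1 \in Ep).
have := base_dart kE; case: k kS {kE} => e []; rewrite /dtail /dhead /= => ->; by [|move <-].
Qed.

Lemma card_base : #|S| = #|ES|.+1.
Proof.
apply/eqP; rewrite eqn_leq; apply/andP; split.
  apply: (leq_trans (card_connect_le _ _)); rewrite ltnS subset_leq_card //.
  by apply/fintype.subsetP => e; rewrite !inE.
apply: (tree_card_edges treeT (s := psiV v0)) => [|f /ES_ends/andP//].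
by rewrite inE connect0.
Qed.

Lemma base_deg u : u \in S ->
  \sum_(v in C | psiV v == u) ldeg v = \sum_(v in C | psiV v == psiV v0) ldeg v.
Proof.
rewrite inE; move: u; apply: connect_ind => // u u' _ <- /adjP[k [kE <- <-]].
have deg k' : \sum_(v in C | psiV v == dtail k') ldeg v =
    \sum_(d : dart (Gam X) | (psiD d == k') && (dtail d \in C)) expf d.1.
  apply/esym/(@sum_expf_over _ [set dtail k']%SET); last exact: finset.set11.
  by move=> ? /set1P ->.
rewrite -dtail_rev !deg reindex_drev; apply: eq_bigl => d.
rewrite psiD_eq_rev drevK; have [dk|//] := eqVneq (psiD d) k.
by rewrite dtail_rev /= class_dart ?dk.
Qed.

Hypothesis genus1 :
  #|[set e in lift_edges | connect (adj lift_edges) v0 (src e)]%SET| +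
  \sum_(v | connect (adj lift_edges) v0 v) genus X v = #|C|.

Let deg := \sum_(v in C | psiV v == psiV v0) ldeg v.

Lemma class_edges :
  #|[set e in lift_edges | connect (adj lift_edges) v0 (src e)]%SET| * 2 =
  \sum_(f in ES) (lifts C (f, true) + lifts C (f, false)).
Proof.
have lifts_rev f : f \in ES -> lifts C (f, false) = lifts C (f, true).
  rewrite inE => /andP[fE _]; rewrite /lifts -!sum1dep_card reindex_drev.
  apply: eq_bigl => d; rewrite psiD_eq_rev; have [df|//] := eqVneq (psiD d) (drev (f, false)).
  by rewrite dtail_rev /= class_dart ?df.
rewrite (eq_bigr (fun f => lifts C (f, true) * 2)) => [|f /lifts_rev ->]; last first.
  by rewrite muln2 addnn.
rewrite -big_distrl /=; congr (_ * _).
rewrite -sum1dep_card (partition_big (@psiE _ X) (mem ES)) /=.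
  apply: eq_bigr => f fES; rewrite /lifts -!sum1dep_card.
  rewrite (reindex_onto (fun e => (e, true) : dart (Gam X)) fst) /=; last first.
    by case=> e c /andP[/eqP[_ ->]].
  apply: eq_bigl => e; rewrite eqxx andbT /psiD xpair_eqE eqxx andbT andbC /=.
  have [ef|//] := eqVneq (psiE e) f; rewrite /= /dtail /=.
  have fE : psiE e \in Ep by move: fES; rewrite -ef inE => /andP[].
  rewrite !inE fE /=; have [ce|] := boolP (connect _ _ _); rewrite ?andbF //.
  by rewrite andbT; apply: class_sub; rewrite inE.
move=> e /andP[]; rewrite inE => /andP[eE _] ce; rewrite inE eE /= psi_src.
by apply: class_base; rewrite inE.
Qed.

Lemma class_count :
  2 * deg + \sum_(k : dart T | is_exit k) lifts C k =
  deg * #|[set k | is_exit k]%SET| + #|[set i | legR X i \in C]%SET|.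
Proof.
have := riemann_hurwitz_region class_base base_deg.
have split F : \sum_(k : dart T | dtail k \in S) F k =
    \sum_(k : dart T | is_exit k) F k + \sum_(f in ES) (F (f, true) + F (f, false)).
  rewrite (@sum_region _ _ _ ES); last exact: ES_ends.
  congr (_ + _); apply: eq_bigl => k; rewrite /is_exit.
  by have [kS|//] := boolP (dtail k \in S); rewrite ES_exit.
rewrite -[#|[set k | dtail k \in S]%SET|]sum1dep_card !split sum1dep_card -class_edges.
have -> : \sum_(v in C) genus X v = \sum_(v | connect (adj lift_edges) v0 v) genus X v.
  by apply: eq_bigl => v; rewrite inE.
rewrite sum_nat_const card_base -genus1 -/deg; nia.
Qed.

Lemma deg_class : deg = 2.
Proof.
have deg_gt0 : 0 < deg.
  by rewrite /deg (bigD1 v0) ?eqxx ?inE ?connect0 //= addn_gt0 ldeg_gt0.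
have deg_le2 : deg <= 2.
  have := @cover_deg2 _ X (psiV v0); rewrite (bigID (mem C)) /=.
  by under eq_bigl do rewrite andbC; move=> <-; exact: leq_addr.
suff : deg != 1 by lia.
apply/eqP => deg1; have := class_count; rewrite deg1.
have -> : #|[set i | legR X i \in C]%SET| = 0.
  apply: eq_card0 => i; rewrite !inE; apply/negP => iC.
  have iC' : legR X i \in C by rewrite inE.
  have := base_deg (class_base iC'); rewrite -/deg deg1 (bigD1 (legR X i)) ?iC' ?eqxx //=.
  by rewrite leg_ramified.
rewrite (eq_bigr (fun=> 1)) => [|k /andP[kS _]]; first by rewrite sum1dep_card; lia.
have := sum_expf_over base_deg kS; rewrite -/deg deg1 => expf1.
have expf_eq1 d : (psiD d == k) && (dtail d \in C) -> expf d.1 = 1.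
  move=> dk; apply/eqP; rewrite eqn_leq expf_gt0 andbT -expf1 (bigD1 d) //=.
  exact: leq_addr.
by rewrite -[RHS]expf1 /lifts -sum1dep_card; apply: eq_bigr => d /expf_eq1 ->.
Qed.

Lemma class_full v : psiV v \in S -> v \in C.
Proof.
move=> vS; apply: contraT => vC; have := base_deg vS; rewrite -/deg deg_class.
have := cover_deg2 (psiV v); rewrite (bigID (mem C)) /=.
under eq_bigl do rewrite andbC.
rewrite [X in _ + X](bigD1 v) ?eqxx ?vC //=.
by have := ldeg_gt0 v; lia.
Qed.

Lemma class_preim : C = preim_vert S.
Proof. by apply/finset.setP => v; rewrite [RHS]inE; apply/idP/idP => [/class_base|/class_full]. Qed.

Lemma base_side k : is_exit k -> forall u, u \in S -> u \notin side k.
Proof.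
move=> /andP[kS kE] u uS; rewrite -(side_drev treeT) inE dhead_rev.
have : connect (adj Ep) (dtail k) u.
  move: kS uS; rewrite !inE => kS; apply: connect_trans.
  by rewrite connect_adj_sym.
apply: connect_sub => x y /adjP[d [dE <- <-]]; apply/connect1/adj_dart.
by rewrite !inE /=; apply: contraNneq kE => <-.
Qed.

Lemma exit_disjoint h k u : is_exit h -> is_exit k -> h != k ->
  u \in side h -> u \notin side k.
Proof.
move=> hX kX hk uh; have kh : k.1 != h.1.
  apply: contra hk => /eqP/dart_same_edge[->//|kh].
  have /andP[+ _] := kX; rewrite kh dtail_rev => /(base_side hX).
  by rewrite dhead_side.
have tk : dtail k \notin side h by case/andP: kX => kS _; exact: base_side.
have := @connect_avoid _ h k u kh tk uh => hu.
rewrite -(side_drev treeT) inE dhead_rev /=; apply: connect_trans hu.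
have /andP[hS _] := hX; have := base_side kX hS.
by rewrite -(side_drev treeT) inE dhead_rev.
Qed.

Lemma exists_exit u : u \notin S -> exists2 k, is_exit k & u \in side k.
Proof.
move=> uS; suff exit_from n (h : dart T) : #|side h| < n -> dtail h \in S ->
    u \in side h -> exists2 k, is_exit k & u \in side k.
  have v0S : psiV v0 \in S by rewrite inE connect0.
  have ne : psiV v0 != u by apply: contraNneq uS => <-.
  have [h hv uh] := exists_dart_to treeT ne.
  by apply: (exit_from #|side h|.+1 h); rewrite ?hv.
elim: n h => // n IHn h /ltnSE hn hS uh.
have [hE|hE] := boolP (h.1 \in Ep); last by exists h; rewrite // /is_exit hS.
have hS' : dhead h \in S by rewrite -base_dart.
have [uh'|/(exists_next_dart treeT uh)[k [tk kh uk]]] := eqVneq u (dhead h).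
  by move: uS; rewrite uh' hS'.
apply: (IHn k) => //; last by rewrite tk.
exact: leq_trans (proper_card (side_proper treeT tk kh)) hn.
Qed.

Lemma sum_branches_exit :
  #|[set i | legB X i \in S]%SET| + \sum_(k : dart T | is_exit k) branches k = 6.
Proof.
rewrite -sum1dep_card -[RHS](card_ord 6) -[RHS]sum1_card.
have -> : \sum_(k : dart T | is_exit k) branches k =
    \sum_(i : 'I_6) \sum_(k : dart T | is_exit k && (legB X i \in side k)) 1.
  rewrite (exchange_big_dep is_exit) /=; last by move=> ? ? _ /andP[].
  apply: eq_bigr => k kX; rewrite /branches -sum1dep_card.
  by apply: eq_bigl => i; rewrite kX.
rewrite big_mkcond -big_split /=; apply: eq_bigr => i _.
have [iS|/exists_exit[k kX ik]] := boolP (legB X i \in S).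
  by rewrite big1 // => k /andP[/base_side/(_ _ iS)/negPf ->].
rewrite (big_pred1 k) // => h /=; apply/andP/eqP => [[hX ih]|->//].
by apply/eqP; apply: contraT => /(exit_disjoint hX kX)/(_ ih); rewrite ik.
Qed.

Lemma exists_main_exit : exists k, [/\ is_exit k, 1 < branches k <= 3 &
  forall h, h != k -> is_exit h -> branches h <= 1].
Proof.
have := class_count; rewrite deg_class class_preim card_legs_preim.
rewrite (eq_bigr over) => [cnt|k /andP[kS _]]; last exact: lifts_preim_vert.
have /eqP/sum_nat_eq1[k [kX k1 k0]] :
    \sum_(k : dart T | is_exit k) (branches k)./2 = 1.
  have := sum_branches_exit; move: cnt.
  have : \sum_(k : dart T | is_exit k) (over k + branches k) =
         \sum_(k : dart T | is_exit k) (2 + 2 * (branches k)./2).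
    apply: eq_bigr => k _; have := over_le2 k; have := over_gt0 k.
    by have := odd_over k; lia.
  by rewrite !big_split /= sum_nat_cond_const big1_eq /=; lia.
exists k; split=> //; first by lia.
by move=> h hk hX; have := k0 h hk hX; lia.
Qed.

End Component.
End Cover.

(** * Topology of the realisation *)

Section DartPoints.
Variables (R : realType) (G : metric_graph R).
Implicit Types (e : edge G) (d : dart G) (t : R).

Definition dart_pt d t : gpoint G :=
  edge_pt d.1 (if d.2 then t else len d.1 - t).

Lemma edge_pt_le0 e t : t <= 0 -> edge_pt e t = Vtx (src e).
Proof. by move=> t0; rewrite /edge_pt insubF ?t0 // ltNge t0. Qed.

Lemma edge_pt_ge_len e t : len e <= t -> edge_pt e t = Vtx (tgt e).
Proof.
move=> et; rewrite /edge_pt insubF ?ifF //; last by rewrite andbC ltNge et.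
by rewrite leNgt (lt_le_trans (len_gt0 e) et).
Qed.

Lemma dart_pt0 d : dart_pt d 0 = Vtx (dtail d).
Proof.
case: d => e []; rewrite /dart_pt /=; first by rewrite edge_pt_le0.
by rewrite subr0 edge_pt_ge_len.
Qed.

Lemma dart_pt_len d : dart_pt d (len d.1) = Vtx (dhead d).
Proof.
case: d => e []; rewrite /dart_pt /=; first by rewrite edge_pt_ge_len.
by rewrite subrr edge_pt_le0.
Qed.

Lemma edge_pt_continuous e : continuous (edge_pt e).
Proof. by apply/continuousP => U; apply. Qed.

Lemma dart_pt_continuous d : continuous (dart_pt d).
Proof.
case: d => e []; first exact: edge_pt_continuous.
move=> t; apply: (@continuous_comp _ _ _ (fun t => len e - t) (edge_pt e)).
  by apply: continuousB; [exact: cst_continuous | exact: cvg_id].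
exact: edge_pt_continuous.
Qed.

Lemma lin_ext_edge_pt (f : vert G -> R) e t : 0 <= t <= len e ->
  lin_ext f (edge_pt e t) = f (src e) + t / len e * (f (tgt e) - f (src e)).
Proof.
move=> /andP[t0 te]; have [t0'|t_gt0] := leP t 0.
  have -> : t = 0 by apply/le_anti; rewrite t0' t0.
  by rewrite edge_pt_le0 //= mul0r mul0r addr0.
have [te'|t_lt] := leP (len e) t.
  have -> : t = len e by apply/le_anti; rewrite te' te.
  rewrite edge_pt_ge_len //= divff ?mul1r ?subrKC //.
  by rewrite gt_eqF ?len_gt0.
rewrite /edge_pt; case: insubP => [x _ <- //|]; by rewrite t_gt0 t_lt.
Qed.

Lemma lin_ext_dart_pt (f : vert G -> R) d t : 0 <= t <= len d.1 ->
  lin_ext f (dart_pt d t) =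
  f (dtail d) + t / len d.1 * (f (dhead d) - f (dtail d)).
Proof.
case: d => e []; rewrite /dart_pt /dtail /dhead /= => te; rewrite lin_ext_edge_pt //.
  by rewrite mulrBl divff ?gt_eqF ?len_gt0 //; ring.
by move/andP: te => [? ?]; rewrite subr_ge0 lerBlDr lerDl; apply/andP.
Qed.

Lemma exists_dart_pt d t :
  exists2 s, 0 <= s <= len d.1 & edge_pt d.1 t = dart_pt d s.
Proof.
case: d => e b; rewrite /dart_pt /=; have e0 := ltW (len_gt0 e).
have [s s0e ->] : exists2 s, 0 <= s <= len e & edge_pt e t = edge_pt e s.
  have [t0|t_gt0] := leP t 0.
    by exists 0; rewrite ?lexx ?e0 // !edge_pt_le0.
  have [te|t_lt] := leP (len e) t; last by exists t; rewrite ?ltW.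
  by exists (len e); rewrite ?lexx ?e0 // !edge_pt_ge_len.
case: b; [by exists s | exists (len e - s); last by rewrite subKr].
by move/andP: s0e => [? ?]; rewrite subr_ge0 lerBlDr lerDl; apply/andP.
Qed.

Lemma component_dart (U A : set (gpoint G)) d (I : interval R) t s :
  is_component U A -> (forall r, r \in I -> U (dart_pt d r)) ->
  t \in I -> A (dart_pt d t) -> s \in I -> A (dart_pt d s).
Proof.
move=> [p Up ->] IU tI pt sI.
rewrite (same_connected_component pt).
have IC : connected (dart_pt d @` [set` I]).
  apply: connected_continuous_connected.
    by apply/connected_intervalP; exact: interval_is_interval.
  exact: continuous_subspaceT (@dart_pt_continuous d).
have ptI : (dart_pt d @` [set` I]) (dart_pt d t) by exists t.
have IU' : dart_pt d @` [set` I] `<=` U by move=> _ [r rI <-]; exact: IU.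
by apply: (connected_component_max ptI IU' IC); exists s.
Qed.

Lemma closure_dart_pt (A : set (gpoint G)) d :
  (forall t, 0 <= t < len d.1 -> A (dart_pt d t)) -> closure A (Vtx (dhead d)).
Proof.
move=> At B; rewrite -dart_pt_len => nB.
have nB' : \forall t \near (len d.1)^'-, B (dart_pt d t).
  exact: (cvg_at_left_filter (@dart_pt_continuous d (len d.1))) nB.
have [t [t0 [tl Bt]]] := filter_ex (filterI (nbhs_left_ge (len_gt0 d.1))
  (filterI (nbhs_left_lt (len d.1)) nB')).
by exists (dart_pt d t); split=> //; apply: At; apply/andP.
Qed.

End DartPoints.

(** * The genus one component *)

Section Degeneration.
Variables (R : realType) (X : hyp_adm_cover R).
Local Notation T := (GamT X).
Implicit Types (d : dart (Gam X)) (h k : dart T).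

Lemma trop_psi_edge_pt (e : edge (Gam X)) t :
  trop_psi (edge_pt e t) = edge_pt (psiE e) ((expf e)%:R * t).
Proof.
have e0 : 0 < (expf e)%:R :> R by rewrite ltr0n expf_gt0.
have [t0|t_gt0] := leP t 0.
  by rewrite !edge_pt_le0 ?pmulr_rle0 //= psi_src.
have [te|t_lt] := leP (len e) t.
  by rewrite !edge_pt_ge_len ?len_dilation ?ler_pM2l //= psi_tgt.
by rewrite {1}/edge_pt; case: insubP => [x _ /= -> //|]; rewrite t_gt0 t_lt.
Qed.

Lemma trop_psi_dart_pt d t :
  trop_psi (dart_pt d t) = dart_pt (psiD d) ((expf d.1)%:R * t).
Proof.
by case: d => e []; rewrite /dart_pt trop_psi_edge_pt //= len_dilation mulrBr.
Qed.

Variables (w : vert (Gam X) -> nat) (lamT : vert T -> vert T -> R).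
Hypothesis hlam : admissible_family w lamT.

Let lam_solves v0 : solves v0 (lamT v0). Proof. by have [] := hlam v0. Qed.

Definition posT (q : gpoint T) : Prop := exists v0, 0 < lin_ext (lamT v0) q.

Lemma Delta_oP p : Delta_o lamT p <-> posT (trop_psi p).
Proof.
split=> [/bigmax_gtP[|[v0 _ ?]]|[v0 ?]]; first by rewrite ltxx.
  by exists v0.
by apply/bigmax_gtP; right; exists v0.
Qed.

Lemma weight_posT v : posT (Vtx (psiV v)) -> w v = 0%N.
Proof. by move=> [v0 v_gt0]; have [_ [w0 _]] := hlam v0; exact: w0. Qed.

Lemma exists_weight v0 : exists2 v, (0 < w v)%N & 0 <= lamT v0 (psiV v).
Proof.
have [_ [_ w1]] := hlam v0; have [v /andP[v_ge0 wv]|none] :=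
  pickP (fun v => (0 <= lamT v0 (psiV v)) && (0 < w v)%N); first by exists v.
move: w1; rewrite big1 // => v v_ge0; have := none v.
by rewrite [0 <= lamT v0 (psiV v)]v_ge0 /= lt0n => /negbFE/eqP.
Qed.

Lemma lin_ext_head (f : vert T -> R) h t : 0 <= t <= len h.1 ->
  f (dhead h) < f (dtail h) -> f (dhead h) <= lin_ext f (dart_pt h t).
Proof.
move=> /[dup] /andP[t0 tl] /lin_ext_dart_pt -> lt_ht.
have : 0 <= (1 - t / len h.1) * (f (dtail h) - f (dhead h)).
  by rewrite mulr_ge0 ?subr_ge0 ?(ltW lt_ht) // ler_pdivrMr ?len_gt0 ?mul1r.
by lra.
Qed.

Lemma lin_ext_gt0 (f : vert T -> R) h t : 0 <= t < len h.1 ->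
  0 <= f (dhead h) -> f (dhead h) < f (dtail h) -> 0 < lin_ext f (dart_pt h t).
Proof.
move=> /andP[t0 tl] h0 lt_ht; rewrite lin_ext_dart_pt ?t0 ?ltW //.
have : 0 < (1 - t / len h.1) * (f (dtail h) - f (dhead h)).
  by rewrite mulr_gt0 ?subr_gt0 // ltr_pdivrMr ?len_gt0 ?mul1r.
by lra.
Qed.

Definition posE : {set edge T} := [set f | `[< forall t, posT (edge_pt f t) >]]%SET.

Lemma exit_pt k : k.1 \notin posE ->
  exists2 t, 0 <= t <= len k.1 & forall v0, lin_ext (lamT v0) (dart_pt k t) <= 0.
Proof.
rewrite inE => /asboolPn/existsNP[t0 npos]; have [t tl te] := exists_dart_pt k t0.
by exists t => // v0; rewrite leNgt -te; apply/negP => ?; apply: npos; exists v0.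
Qed.

Lemma exit_head_le0 k v0 : k.1 \notin posE ->
  lamT v0 (dhead k) < lamT v0 (dtail k) -> lamT v0 (dhead k) <= 0.
Proof.
by move=> /exit_pt[t tl t0] lt_ht; apply: le_trans (t0 v0); exact: lin_ext_head.
Qed.

Lemma exit_pole k v0 : k.1 \notin posE -> (1 < branches k)%N ->
  0 < lamT v0 (dtail k) -> v0 \in side k.
Proof.
move=> /exit_pt[t /[dup] tl /andP[t0 _] /(_ v0) le0] bk v0_gt0; apply: contraLR le0 => v0k.
have := slope_lam lam_solves v0 k; rewrite (negPf v0k) subr0 /slope => sl.
have sl_ge0 : 0 <= lamT v0 (dhead k) - lamT v0 (dtail k).
  rewrite -(@pmulr_lge0 _ (len k.1)^-1) ?invr_gt0 ?len_gt0 // sl.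
  have : 2 <= (branches k)%:R :> R by rewrite ler_nat.
  by lra.
rewrite -ltNge lin_ext_dart_pt // ltr_wpDr // mulr_ge0 //.
by rewrite divr_ge0 // ltW // len_gt0.
Qed.

Variable Delta1 : set (gpoint (Gam X)).
Hypothesis hcomp : is_component (Delta_o lamT) Delta1.

Local Notation VS := (verts_in Delta1).

Lemma component_sub p : Delta1 p -> posT (trop_psi p).
Proof.
by case: hcomp => [q _ ->] /connected_component_sub /Delta_oP.
Qed.

Lemma component_pos_edge d t s : psiE d.1 \in posE ->
  Delta1 (dart_pt d t) -> Delta1 (dart_pt d s).
Proof.
rewrite inE => /asboolP pos dt.
apply: (component_dart (I := `]-oo, +oo[) (t := t) hcomp) => // r _.
by apply/Delta_oP; rewrite trop_psi_dart_pt; exact: pos.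
Qed.

Lemma component_src_tgt (e : edge (Gam X)) :
  psiE e \in posE -> (src e \in VS) = (tgt e \in VS).
Proof.
move=> ePos; have := dart_pt_len (e, true); have := dart_pt0 (e, true).
rewrite /dtail /dhead !inE /= => <- <-.
by apply/asboolP/asboolP; exact: (@component_pos_edge (e, true)).
Qed.

Lemma edges_in_component : edges_in Delta1 = lift_edges posE VS.
Proof.
apply/finset.setP => e; rewrite !inE; apply/asboolP/andP => [De|[ePos /asboolP srcD] t].
  split; last by apply/asboolP; rewrite -(edge_pt_le0 e (lexx 0)).
  apply/asboolP => t; have := component_sub (De (t / (expf e)%:R)).
  rewrite trop_psi_edge_pt mulrC divfK // pnatr_eq0 -lt0n; exact: expf_gt0.
apply: (@component_pos_edge (e, true) 0 t); first by rewrite inE.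
by rewrite dart_pt0.
Qed.

Variable r : vert (Gam X).
Hypothesis rD : r \in VS.
Hypothesis genus1 :
  (#|[set e in lift_edges posE VS | connect (adj (lift_edges posE VS)) r (src e)]%SET| +
  \sum_(v | connect (adj (lift_edges posE VS)) r v) genus X v =
  #|[set v | connect (adj (lift_edges posE VS)) r v]%SET|)%N.

Lemma base_component v : psiV v \in [set u | connect (adj posE) (psiV r) u]%SET -> v \in VS.
Proof. by move=> /(class_full component_src_tgt rD genus1)/(class_sub component_src_tgt rD). Qed.

Lemma boundary_vertex k v : is_exit posE r k -> psiV v = dhead k -> (0 < w v)%N ->
  (forall t, 0 <= t < len k.1 -> posT (dart_pt k t)) ->
  boundary Delta1 (Vtx v).
Proof.
move=> /andP[kS kE] vk wv pos.
have [d dk dv] : exists2 d, psiD d = k & dhead d = v.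
  have [|d dk dv] := @exists_lift _ _ v (drev k); first by rewrite dtail_rev.
  by exists (drev d); rewrite ?dhead_rev // psiD_rev dk drevK.
split; last first.
  move=> /interior_subset/component_sub/weight_posT w0.
  by rewrite w0 in wv.
have tailD : Delta1 (dart_pt d 0).
  rewrite dart_pt0; have : dtail d \in VS by rewrite base_component // -dtail_psi dk.
  by rewrite inE => /asboolP.
rewrite -dv; apply: closure_dart_pt => t tl.
have e0 : 0 < (expf d.1)%:R :> R by rewrite ltr0n expf_gt0.
apply: (component_dart (I := `[0, len d.1[) (t := 0) hcomp) => //.
- move=> s; rewrite in_itv /= => /andP[s0 sl]; apply/Delta_oP.
  rewrite trop_psi_dart_pt dk; apply: pos; rewrite mulr_ge0 ?(ltW e0) //=.
  by rewrite -dk /= len_dilation ltr_pM2l.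
- by rewrite in_itv /= lexx len_gt0.
Qed.

Lemma exists_boundary_weight : exists v, (0 < w v)%N /\ boundary Delta1 (Vtx v).
Proof.
have [h [hX /andP[bh bh3] others]] := exists_main_exit component_src_tgt rD genus1.
have /andP[hS hE] := hX.
have [u uh uP] := exists_pole lam_solves bh3.
have [v wv v_ge0] := exists_weight u.
have [vh|vh] := boolP (psiV v \in side h).
  have dec := lam_decr2 lam_solves bh3 uh; have le0 := exit_head_le0 hE dec.
  have vE : psiV v = dhead h.
    apply/eqP; apply: contraT => /(uP _ vh)/(le_lt_trans v_ge0).
    by rewrite ltNge le0.
  exists v; split=> //; apply: (boundary_vertex hX vE wv) => t tl.
  by exists u; apply: lin_ext_gt0 => //; rewrite -vE.
pose v0 := [arg max_(x > u) lamT x (dtail h)]%O.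
have v0_max x : lamT x (dtail h) <= lamT v0 (dtail h).
  by rewrite /v0; case: arg_maxP => // i _; exact.
have v0h : v0 \in side h.
  apply: (exit_pole hE bh).
  have [s hs] : exists s, dtail h = psiV s.
    have [s /eqP ?|none] := pickP (fun s => psiV s == dtail h); first by exists s.
    by have := cover_deg2 (dtail h); rewrite big_pred0.
  have : s \in VS by rewrite base_component // -hs.
  rewrite inE => /asboolP/component_sub[x]; rewrite /= -hs => /lt_le_trans.
  by apply.
have v_ge0' : 0 <= lamT v0 (psiV v).
  have := lam_sub_const lam_solves uh v0h vh; have := v0_max u.
  by move: v_ge0; lra.
have [vS|/(exists_exit)[k kX vk]] :=
    boolP (psiV v \in [set u | connect (adj posE) (psiV r) u]%SET).
  have := base_component vS; rewrite inE => /asboolP/component_sub/weight_posT w0.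
  by rewrite w0 in wv.
have hk : h != k by apply: contraNneq vh => ->.
have bk : (branches k <= 1)%N by apply: others => //; rewrite eq_sym.
have v0k := exit_disjoint hX kX hk v0h.
have dec := lam_decr1 lam_solves bk v0k.
have /andP[_ kE] := kX; have le0 := exit_head_le0 kE dec.
have vE : psiV v = dhead k.
  apply/eqP; apply: contraT => /(lam_side_lt_head lam_solves bk v0k vk)/(le_lt_trans v_ge0').
  by rewrite ltNge le0.
exists v; split=> //; apply: (boundary_vertex kX vE wv) => t tl.
by exists v0; apply: lin_ext_gt0 => //; rewrite -vE.
Qed.

End Degeneration.

Theorem lemma3p28 (R : realType) (X : hyp_adm_cover R)
    (w : vert (Gam X) -> nat) (hw : stable_weight w)
    (lamT : vert (GamT X) -> vert (GamT X) -> R)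
    (hlam : admissible_family w lamT)
    (Delta1 : set (gpoint (Gam X)))
    (hcomp : is_component (Delta_o lamT) Delta1)
    (hgenus : genus_of_subset (genus X) Delta1 = 1) :
  exists v : vert (Gam X), (0 < w v)%N /\ boundary Delta1 (Vtx v).
Proof.
move: hgenus; rewrite /genus_of_subset (edges_in_component hcomp).
move=> /exists_class_genus1[e|e|r rD].
- by rewrite inE => /andP[/(component_src_tgt hcomp)].
- by rewrite inE => /andP[].
exact: (exists_boundary_weight hlam hcomp rD).
Qed.
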